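(* Let $(R,V)$ be a braided vector space and, for $n\ge 3$, let $\rho^R$ be the corresponding representation of the braid group $\mathcal{B}_n$ on $V^{\otimes n}$. Let $P$ be the flip operator on $V\otimes V$, $P(x\otimes y)=y\otimes x$. Then setting $$\rho^R(\tau)=(P\otimes I_V^{\otimes n-2})(I_V\otimes P\otimes I_V^{\otimes n-3})\cdots(I_V^{\otimes n-2}\otimes P)$$ defines an extension of $\rho^R$ to a representation of the necklace braid group $\mathcal{NB}_n$ on $V^{\otimes n}$ (where $\rho^R(\sigma_n)=\rho^R(\tau)\rho^R(\sigma_{n-1})\rho^R(\tau)^{-1}$).
   Context: A braided vector space is a pair $(R,V)$ where $V$ is a vector space and $R\in\mathrm{Aut}(V^{\otimes 2})$ satisfies the Yang–Baxter equation $(R\otimes I_V)(I_V\otimes R)(R\otimes I_V)=(I_V\otimes R)(R\otimes I_V)(I_V\otimes R)$ on $V^{\otimes 3}$. The braid group $\mathcal{B}_n$ is generated by $\sigma_1,\dots,\sigma_{n-1}$ with relations $\sigma_i\sigma_{i+1}\sigma_i=\sigma_{i+1}\sigma_i\sigma_{i+1}$ and $\sigma_i\sigma_j=\sigma_j\sigma_i$ for $|i-j|>1$; the representation $\rho^R$ of $\mathcal{B}_n$ on $V^{\otimes n}$ is given by $\rho^R(\sigma_i)=I_V^{\otimes (i-1)}\otimes R\otimes I_V^{\otimes (n-i-1)}$. The necklace braid group $\mathcal{NB}_n$ is the group with generators $\sigma_1,\dots,\sigma_n,\tau$ and relations, with all indices taken modulo $n$: (B1) $\sigma_i\sigma_{i+1}\sigma_i=\sigma_{i+1}\sigma_i\sigma_{i+1}$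 for all $i$; (B2) $\sigma_i\sigma_j=\sigma_j\sigma_i$ whenever $i-j\not\equiv\pm1\pmod n$; (N1) $\tau\sigma_i\tau^{-1}=\sigma_{i+1}$ for $1\le i\le n$; (N2) $\tau^{2n}=1$. *)

(* Defs.v *)
From HB Require Import structures.
From mathcomp Require Import all_boot all_algebra.
From mathcomp Require Import generic_quotient zify boolp.

Set Implicit Arguments.
Unset Strict Implicit.
Unset Printing Implicit Defensive.
Import GRing.Theory.
Local Open Scope quotient_scope.
Local Open Scope ring_scope.

(* Tensor product of two (possibly infinite-dimensional) vector spaces.
   A sequence [:: (u1, w1); ...; (uk, wk)] stands for the formal sum
   u1 (x) w1 + ... + uk (x) wk; scalars are absorbed in the left factor. *)
Section TensorRel.
Variables (K : fieldType) (U W : lmodType K).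

Inductive tens_rel : seq (U * W) -> seq (U * W) -> Prop :=
| tens_refl s : tens_rel s s
| tens_sym s t : tens_rel s t -> tens_rel t s
| tens_trans t s r : tens_rel s t -> tens_rel t r -> tens_rel s r
| tens_cat s s' t t' :
    tens_rel s s' -> tens_rel t t' -> tens_rel (s ++ t) (s' ++ t')
| tens_comm s t : tens_rel (s ++ t) (t ++ s)
| tens_zero w : tens_rel [:: (0, w)] [::]
| tens_addl u u' w : tens_rel [:: (u + u', w)] [:: (u, w); (u', w)]
| tens_addr u w w' : tens_rel [:: (u, w + w')] [:: (u, w); (u, w')]
| tens_bal (a : K) u w : tens_rel [:: (a *: u, w)] [:: (u, a *: w)].

Definition tens_relb s t := `[< tens_rel s t >].

Lemma tens_relb_equiv : equiv_class_of tens_relb.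
Proof.
split=> [s|s t|t s r].
- by apply/asboolP; apply: tens_refl.
- by apply/asboolP/asboolP; apply: tens_sym.
- by move=> /asboolP h1 /asboolP h2; apply/asboolP; apply: tens_trans h1 h2.
Qed.

Canonical tens_equiv := EquivRelPack tens_relb_equiv.

Definition tensor := {eq_quot tens_equiv}.
HB.instance Definition _ := Choice.on tensor.
HB.instance Definition _ := EqQuotient.on tensor.

Definition fsum (s : seq (U * W)) : tensor := \pi_tensor s.

Lemma fsumP s t : fsum s = fsum t <-> tens_rel s t.
Proof. by split=> [/eqmodP/asboolP|h]; last by apply/eqmodP/asboolP. Qed.

Lemma fsumK (x : tensor) : fsum (repr x) = x.
Proof. exact: reprK. Qed.

Lemma repr_fsum s : tens_rel (repr (fsum s)) s.
Proof. by apply/fsumP; rewrite fsumK. Qed.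

Lemma tensorW (P : tensor -> Prop) : (forall s, P (fsum s)) -> forall x, P x.
Proof. by move=> h x; rewrite -(fsumK x). Qed.

Definition scaleseq (a : K) (s : seq (U * W)) := [seq (a *: p.1, p.2) | p <- s].

Lemma scaleseq_rel a s t :
  tens_rel s t -> tens_rel (scaleseq a s) (scaleseq a t).
Proof.
elim=> {s t}.
- by move=> s; apply: tens_refl.
- by move=> s t _; apply: tens_sym.
- by move=> t s r _ h1 _ h2; apply: tens_trans h1 h2.
- by move=> s s' t t' _ h1 _ h2; rewrite /scaleseq !map_cat; apply: tens_cat.
- by move=> s t; rewrite /scaleseq !map_cat; apply: tens_comm.
- by move=> w /=; rewrite scaler0; apply: tens_zero.
- by move=> u u' w /=; rewrite scalerDr; apply: tens_addl.
- by move=> u w w' /=; apply: tens_addr.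
- move=> b u w /=; rewrite scalerA mulrC -scalerA; exact: tens_bal.
Qed.

Definition tadd (x y : tensor) := fsum (repr x ++ repr y).
Definition tscale a (x : tensor) := fsum (scaleseq a (repr x)).
Definition topp (x : tensor) := tscale (-1) x.

Lemma tadd_fsum s t : tadd (fsum s) (fsum t) = fsum (s ++ t).
Proof. by apply/fsumP; apply: tens_cat; apply: repr_fsum. Qed.

Lemma tscale_fsum a s : tscale a (fsum s) = fsum (scaleseq a s).
Proof. by apply/fsumP; apply: scaleseq_rel; apply: repr_fsum. Qed.

Lemma taddA : associative tadd.
Proof.
elim/tensorW=> s; elim/tensorW=> t; elim/tensorW=> r.
by rewrite !tadd_fsum catA.
Qed.

Lemma taddC : commutative tadd.
Proof.
elim/tensorW=> s; elim/tensorW=> t; rewrite !tadd_fsum.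
by apply/fsumP; apply: tens_comm.
Qed.

Lemma tadd0 : left_id (fsum [::]) tadd.
Proof. by elim/tensorW=> s; rewrite tadd_fsum. Qed.

Lemma fsum_cons p s : fsum (p :: s) = tadd (fsum [:: p]) (fsum s).
Proof. by rewrite tadd_fsum. Qed.

Lemma tscaleDl (x : tensor) a b : tscale (a + b) x = tadd (tscale a x) (tscale b x).
Proof.
elim/tensorW: x => s; rewrite !tscale_fsum.
elim: s => [|[u w] s IHs] /=; first by rewrite tadd_fsum.
rewrite fsum_cons IHs [in RHS]fsum_cons [fsum (_ :: scaleseq b s)]fsum_cons.
rewrite -!taddA [tadd (fsum (scaleseq a s)) (tadd _ _)]taddA.
rewrite [tadd (fsum (scaleseq a s)) (fsum [:: _])]taddC !taddA; congr (tadd (tadd _ _) _).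
by rewrite tadd_fsum; apply/fsumP; rewrite scalerDl; apply: tens_addl.
Qed.

Lemma tscaleDr a : {morph tscale a : x y / tadd x y}.
Proof.
elim/tensorW=> s; elim/tensorW=> t.
by rewrite !(tadd_fsum, tscale_fsum) /scaleseq map_cat.
Qed.

Lemma tscaleA a b x : tscale a (tscale b x) = tscale (a * b) x.
Proof.
elim/tensorW: x => s; rewrite !tscale_fsum /scaleseq -map_comp.
by congr fsum; apply: eq_map => p /=; rewrite scalerA.
Qed.

Lemma tscale1 : left_id 1 tscale.
Proof.
elim/tensorW=> s; rewrite !tscale_fsum /scaleseq.
by congr fsum; apply: map_id_in => -[u w] _ /=; rewrite scale1r.
Qed.

Lemma tscale0 x : tscale 0 x = fsum [::].
Proof.
elim/tensorW: x => s; rewrite !tscale_fsum; elim: s => //= [[u w] s IHs].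
rewrite fsum_cons IHs tadd_fsum scale0r; apply/fsumP; exact: tens_zero.
Qed.

Lemma taddN : left_inverse (fsum [::]) topp tadd.
Proof.
by move=> x; rewrite /topp -[X in tadd _ X]tscale1 -tscaleDl addNr tscale0.
Qed.

HB.instance Definition _ := GRing.isZmodule.Build tensor taddA taddC tadd0 taddN.
HB.instance Definition _ := GRing.Zmodule_isLmodule.Build K tensor
  tscaleA tscale1 tscaleDr tscaleDl.

Definition tens (u : U) (w : W) : tensor := fsum [:: (u, w)].

Lemma tensDl w : {morph (fun u => tens u w) : u u' / u + u'}.
Proof.
by move=> u u'; rewrite [RHS]tadd_fsum; apply/fsumP; apply: tens_addl.
Qed.

Lemma tensDr u : {morph tens u : w w' / w + w'}.
Proof.
by move=> w w'; rewrite [RHS]tadd_fsum; apply/fsumP; apply: tens_addr.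
Qed.

Lemma tensZl a u w : tens (a *: u) w = a *: tens u w.
Proof. by rewrite [RHS]tscale_fsum. Qed.

Lemma tensZr a u w : tens u (a *: w) = a *: tens u w.
Proof. by rewrite -tensZl; apply/fsumP; apply/tens_sym/tens_bal. Qed.

Lemma fsumE s : fsum s = \sum_(p <- s) tens p.1 p.2.
Proof.
elim: s => [|[u w] s IHs]; first by rewrite big_nil.
by rewrite fsum_cons IHs big_cons.
Qed.

Lemma tens_ind (P : tensor -> Prop) :
  (forall u w, P (tens u w)) -> (forall x y, P x -> P y -> P (x + y)) ->
  forall x, P x.
Proof.
move=> Pt PD; elim/tensorW=> s; rewrite fsumE.
elim: s => [|p s IHs]; rewrite ?big_nil ?big_cons; last exact: PD.
by have := Pt 0 0; rewrite -[X in tens X _](scale0r 0) tensZl scale0r.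
Qed.

End TensorRel.

Notation "U ⊗ W" := (tensor U W) (at level 40, left associativity).

Section TensorLift.
Variables (K : fieldType) (U W M : lmodType K).

Definition bilin (f : U -> W -> M) :=
  (forall w, linear (f^~ w)) /\ (forall u, linear (f u)).

Lemma tens_eq (f g : {linear (U ⊗ W) -> M}) :
  (forall u w, f (tens u w) = g (tens u w)) -> f =1 g.
Proof. by move=> h; elim/tens_ind=> [u w|x y hx hy] //; rewrite !linearD hx hy. Qed.

Definition tlift (f : U -> W -> M) (hf : bilin f) (x : U ⊗ W) : M :=
  \sum_(p <- repr x) f p.1 p.2.

Variables (f : U -> W -> M) (hf : bilin f).

Lemma bilinDl u u' w : f (u + u') w = f u w + f u' w.
Proof. by have := hf.1 w 1 u u'; rewrite !scale1r. Qed.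

Lemma bilinDr u w w' : f u (w + w') = f u w + f u w'.
Proof. by have := hf.2 u 1 w w'; rewrite !scale1r. Qed.

Lemma bilin0l w : f 0 w = 0.
Proof. by apply: (addrI (f 0 w)); rewrite -bilinDl !addr0. Qed.

Lemma bilin0r u : f u 0 = 0.
Proof. by apply: (addrI (f u 0)); rewrite -bilinDr !addr0. Qed.

Lemma bilinZl a u w : f (a *: u) w = a *: f u w.
Proof. by have := hf.1 w a u 0; rewrite bilin0l !addr0. Qed.

Lemma bilinZr a u w : f u (a *: w) = a *: f u w.
Proof. by have := hf.2 u a w 0; rewrite bilin0r !addr0. Qed.

Lemma tlift_fsum s : tlift hf (fsum s) = \sum_(p <- s) f p.1 p.2.
Proof.
rewrite /tlift; have := repr_fsum s; move: (repr _) => r.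
elim=> {r s} //=.
- by move=> s t r _ -> _ ->.
- by move=> s s' t t' _ h1 _ h2; rewrite !big_cat /= h1 h2.
- by move=> s t; rewrite !big_cat /= addrC.
- by move=> w; rewrite big_seq1 big_nil bilin0l.
- by move=> u u' w; rewrite !big_cons !big_nil !addr0 bilinDl.
- by move=> u w w'; rewrite !big_cons !big_nil !addr0 bilinDr.
- by move=> a u w; rewrite !big_seq1 bilinZl bilinZr.
Qed.

Lemma tlift_linear : linear (tlift hf).
Proof.
move=> a; elim/tensorW=> s; elim/tensorW=> t.
rewrite [X in tlift hf (X + _)]tscale_fsum [X in tlift hf X]tadd_fsum.
rewrite !tlift_fsum big_cat big_map /= scaler_sumr; congr (_ + _).
by apply: eq_bigr => p _; rewrite bilinZl.
Qed.

HB.instance Definition _ := GRing.isLinear.Build K (U ⊗ W) M _ (tlift hf) tlift_linear.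

Lemma tliftE u w : tlift hf (tens u w) = f u w.
Proof. by rewrite tlift_fsum big_seq1. Qed.

End TensorLift.

Lemma tens_bilin (K : fieldType) (U W : lmodType K) : bilin (@tens K U W).
Proof.
by split=> [w|u] a x y; rewrite ?tensDl ?tensDr ?tensZl ?tensZr.
Qed.

Section TensorMap.
Variables (K : fieldType) (U U' W W' : lmodType K).
Variables (f : {linear U -> U'}) (g : {linear W -> W'}).

Lemma tmap_bilin : bilin (fun u w => tens (f u) (g w)).
Proof.
split=> [w|u] a x y; rewrite linearP.
  by rewrite tensDl tensZl.
by rewrite tensDr tensZr.
Qed.

Definition tmap : {linear (U ⊗ W) -> (U' ⊗ W')} := tlift tmap_bilin.

Lemma tmapE u w : tmap (tens u w) = tens (f u) (g w).
Proof. exact: tliftE. Qed.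

End TensorMap.

HB.instance Definition _ (K : fieldType) (U W : lmodType K) (u : U) :=
  GRing.isLinear.Build K W (U ⊗ W) _ (@tens K U W u) ((tens_bilin U W).2 u).

Definition tensl (K : fieldType) (U W : lmodType K) (w : W) (u : U) := tens u w.

HB.instance Definition _ (K : fieldType) (U W : lmodType K) (w : W) :=
  GRing.isLinear.Build K U (U ⊗ W) _ (@tensl K U W w) ((tens_bilin U W).1 w).

Lemma linear_eq (K : fieldType) (U W : lmodType K) (f g : {linear U -> W}) :
  f =1 g -> f = g.
Proof.
case: f g => [f [[f1] [f2]]] [g [[g1] [g2]]] /= /funext efg; case: _ / efg g1 g2 => g1 g2.
by rewrite (Prop_irrelevance f1 g1) (Prop_irrelevance f2 g2).
Qed.

Record linIso (K : fieldType) (U W : lmodType K) := LinIso {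
  iso_fun :> {linear U -> W};
  iso_inv : {linear W -> U};
  iso_funK : cancel iso_fun iso_inv;
  iso_invK : cancel iso_inv iso_fun }.

Section LinearIso.
Variable K : fieldType.

Lemma linIso_eq (U W : lmodType K) (f g : linIso U W) : f =1 g -> f = g.
Proof.
case: f g => [f f' fK f'K] [g g' gK g'K] /= /linear_eq efg; subst g.
have : f' = g' by apply: linear_eq => x; rewrite -{1}(g'K x) fK.
by move=> efg; subst g'; congr LinIso; apply: Prop_irrelevance.
Qed.

Definition iso_id (U : lmodType K) : linIso U U :=
  @LinIso K U U idfun idfun (fun _ => erefl) (fun _ => erefl).

Definition iso_sym (U W : lmodType K) (f : linIso U W) : linIso W U :=
  @LinIso K W U (iso_inv f) (iso_fun f) (@iso_invK _ _ _ f) (@iso_funK _ _ _ f).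

Lemma iso_compK (U W T : lmodType K) (f : linIso W T) (g : linIso U W) :
  cancel (f \o g) (iso_inv g \o iso_inv f).
Proof. by move=> x /=; rewrite !iso_funK. Qed.

Lemma iso_compVK (U W T : lmodType K) (f : linIso W T) (g : linIso U W) :
  cancel (iso_inv g \o iso_inv f) (f \o g).
Proof. by move=> x /=; rewrite !iso_invK. Qed.

Definition iso_comp (U W T : lmodType K) (f : linIso W T) (g : linIso U W) :
    linIso U T :=
  @LinIso K U T (f \o g) (iso_inv g \o iso_inv f) (iso_compK f g) (iso_compVK f g).

Lemma tmap_cancel (U U' W W' : lmodType K)
    (f : {linear U -> U'}) (f' : {linear U' -> U})
    (g : {linear W -> W'}) (g' : {linear W' -> W}) :
  cancel f f' -> cancel g g' -> cancel (tmap f g) (tmap f' g').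
Proof.
move=> fK gK; elim/tens_ind=> [u w|x y hx hy]; last by rewrite !linearD hx hy.
by rewrite !tmapE fK gK.
Qed.

Definition iso_tens (U U' W W' : lmodType K) (f : linIso U U') (g : linIso W W') :
    linIso (U ⊗ W) (U' ⊗ W') :=
  @LinIso K _ _ (tmap f g) (tmap (iso_inv f) (iso_inv g))
    (tmap_cancel (@iso_funK _ _ _ f) (@iso_funK _ _ _ g))
    (tmap_cancel (@iso_invK _ _ _ f) (@iso_invK _ _ _ g)).

Lemma iso_tensE (U U' W W' : lmodType K) (f : linIso U U') (g : linIso W W') u w :
  iso_tens f g (tens u w) = tens (f u) (g w).
Proof. exact: tmapE. Qed.

Section Assoc.
Variables U W T : lmodType K.

Lemma assoc_bilin : bilin (fun u : U =>
  tmap (tens u : {linear W -> (U ⊗ W)}) (idfun : {linear T -> T})).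
Proof.
split=> [x a u u'|u]; last exact: linearP.
elim/tens_ind: x => [w t|x y hx hy].
  by rewrite !tmapE /= tensDl tensZl tensDl tensZl.
by rewrite !linearD hx hy /= ?scalerDr addrACA.
Qed.

Definition assoc_fun : {linear (U ⊗ (W ⊗ T)) -> ((U ⊗ W) ⊗ T)} := tlift assoc_bilin.

Lemma assocV_bilin : bilin (fun (x : U ⊗ W) (t : T) =>
  tmap (idfun : {linear U -> U}) (tensl t : {linear W -> (W ⊗ T)}) x).
Proof.
split=> [t|x a t t']; first exact: linearP.
elim/tens_ind: x => [u w|x y hx hy].
  by rewrite !tmapE /= /tensl !(tensDr, tensZr).
by rewrite !linearD hx hy ?scalerDr addrACA.
Qed.

Definition assoc_inv : {linear ((U ⊗ W) ⊗ T) -> (U ⊗ (W ⊗ T))} := tlift assocV_bilin.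

Lemma assoc_funE u w t : assoc_fun (tens u (tens w t)) = tens (tens u w) t.
Proof. by apply: (etrans (tliftE _ _ _)); rewrite tmapE. Qed.

Lemma assoc_invE u w t : assoc_inv (tens (tens u w) t) = tens u (tens w t).
Proof. by apply: (etrans (tliftE _ _ _)); rewrite tmapE. Qed.

Lemma assoc_funK : cancel assoc_fun assoc_inv.
Proof.
elim/tens_ind=> [u x|x y hx hy]; last by rewrite !linearD hx hy.
elim/tens_ind: x => [w t|x y hx hy]; first by rewrite assoc_funE assoc_invE.
by rewrite tensDr !linearD hx hy.
Qed.

Lemma assoc_invK : cancel assoc_inv assoc_fun.
Proof.
elim/tens_ind=> [x t|x y hx hy]; last by rewrite !linearD hx hy.
elim/tens_ind: x => [u w|x y hx hy]; first by rewrite assoc_invE assoc_funE.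
by rewrite tensDl !linearD hx hy.
Qed.

Definition tens_assoc : linIso (U ⊗ (W ⊗ T)) ((U ⊗ W) ⊗ T) :=
  @LinIso K _ _ assoc_fun assoc_inv assoc_funK assoc_invK.

End Assoc.

Section Swap.
Variables U W : lmodType K.

Lemma swap_bilin : bilin (fun (u : U) (w : W) => tens w u).
Proof. by split=> [w|u]; [apply: (tens_bilin W U).2 | apply: (tens_bilin W U).1]. Qed.

Definition swap_fun : {linear (U ⊗ W) -> (W ⊗ U)} := tlift swap_bilin.

Lemma swap_funE u w : swap_fun (tens u w) = tens w u.
Proof. exact: tliftE. Qed.

End Swap.

Lemma swapK (U W : lmodType K) : cancel (swap_fun U W) (swap_fun W U).
Proof.
elim/tens_ind=> [u w|x y hx hy]; first by rewrite !swap_funE.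
by rewrite !linearD hx hy.
Qed.

End LinearIso.

Section GeneralLinear.
Variables (K : fieldType) (W : lmodType K).

Definition GL := linIso W W.

HB.instance Definition _ := gen_eqMixin GL.
HB.instance Definition _ := gen_choiceMixin GL.

Definition GL_mul (f g : GL) : GL := iso_comp f g.
Definition GL_one : GL := iso_id W.
Definition GL_inv (f : GL) : GL := iso_sym f.

Lemma GL_mulA : associative GL_mul.
Proof. by move=> f g h; apply: linIso_eq. Qed.

Lemma GL_mul1 : left_id GL_one GL_mul.
Proof. by move=> f; apply: linIso_eq. Qed.

Lemma GL_mulr1 : right_id GL_one GL_mul.
Proof. by move=> f; apply: linIso_eq. Qed.

Lemma GL_mulV : left_inverse GL_one GL_inv GL_mul.
Proof. by move=> f; apply: linIso_eq => x /=; rewrite iso_funK. Qed.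

Lemma GL_mulrV : right_inverse GL_one GL_inv GL_mul.
Proof. by move=> f; apply: linIso_eq => x /=; rewrite iso_invK. Qed.

HB.instance Definition _ := isGroup.Build GL GL_mulA GL_mul1 GL_mulr1 GL_mulV GL_mulrV.

End GeneralLinear.

Local Open Scope group_scope.

Lemma GL_mulE (K : fieldType) (W : lmodType K) (f g : GL W) x : (f * g) x = f (g x).
Proof. by []. Qed.

Lemma GL_oneE (K : fieldType) (W : lmodType K) x : (1 : GL W) x = x.
Proof. by []. Qed.

Section TensorPower.
Variables (K : fieldType) (V : lmodType K).

Fixpoint tpow (n : nat) : lmodType K :=
  if n is n'.+1 then V ⊗ tpow n' else K^o.

Definition flip : GL (V ⊗ V) :=
  @LinIso K _ _ (swap_fun V V) (swap_fun V V) (@swapK K V V) (@swapK K V V).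

(* F ⊗ I_T on V ⊗ (V ⊗ T), through the associator *)
Definition act_head (F : GL (V ⊗ V)) (T : lmodType K) : GL (V ⊗ (V ⊗ T)) :=
  iso_comp (iso_sym (tens_assoc V V T))
    (iso_comp (iso_tens F (iso_id T)) (tens_assoc V V T)).

(* act F n i is I^{⊗ i} ⊗ F ⊗ I^{⊗ (n - i - 2)} when i + 2 <= n, that is, F
   acting on the tensor factors number i and i + 1, counted from 0; it is the
   identity when i + 2 > n. *)
Fixpoint act (F : GL (V ⊗ V)) (n i : nat) : GL (tpow n) :=
  match n, i return GL (tpow n) with
  | 0, _ => 1
  | n'.+1, i'.+1 => iso_tens (1 : GL V) (act F n' i')
  | n'.+1, 0 => if n' is m.+1 return GL (tpow n'.+1) then act_head F (tpow m) else 1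
  end.

Definition yang_baxter (R : GL (V ⊗ V)) : Prop :=
  act R 3 0 * act R 3 1 * act R 3 0 = act R 3 1 * act R 3 0 * act R 3 1.

End TensorPower.

Arguments tmap : simpl never.
Arguments iso_tens : simpl never.
Arguments act_head : simpl never.

Section ActTheory.
Variables (K : fieldType) (V : lmodType K).
Implicit Types F G R : GL (V ⊗ V).

Lemma act_headE F T x y t :
  act_head F T (tens x (tens y t)) = assoc_inv V V T (tens (F (tens x y)) t).
Proof.
rewrite -[LHS]/(assoc_inv V V T (iso_tens F (iso_id T) (assoc_fun V V T _))).
by rewrite assoc_funE iso_tensE.
Qed.

Lemma act_head_nat F (T T' : lmodType K) (phi : {linear T -> T'}) z :
  let e := tmap (idfun : {linear V -> V}) (tmap (idfun : {linear V -> V}) phi) in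
  act_head F T' (e z) = e (act_head F T z).
Proof.
cbv zeta; elim/tens_ind: z => [x z|x y hx hy]; last by rewrite !linearD hx hy.
elim/tens_ind: z => [y t|y z hy hz]; last by rewrite tensDr !linearD hy hz.
rewrite !tmapE act_headE [act_head F T _]act_headE; move: (F _) => s.
elim/tens_ind: s => [a b|a b ha hb]; last by rewrite !tensDl !linearD ha hb.
by rewrite !assoc_invE !tmapE.
Qed.

Lemma iso_tensM (U W : lmodType K) (f f' : GL U) (g g' : GL W) :
  (iso_tens f g : GL (U ⊗ W)) * iso_tens f' g' = iso_tens (f * f') (g * g').
Proof.
apply: linIso_eq => x; rewrite GL_mulE; elim/tens_ind: x => [u w|x y hx hy].
  by rewrite !iso_tensE.
by rewrite !linearD hx hy.
Qed.

Lemma act_headC F (T : lmodType K) (h : GL T) :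
  act_head F T * iso_tens (1 : GL V) (iso_tens (1 : GL V) h) =
  (iso_tens (1 : GL V) (iso_tens (1 : GL V) h) : GL (V ⊗ (V ⊗ T))) * act_head F T.
Proof. by apply: linIso_eq => z; apply: (act_head_nat F (iso_fun h)). Qed.

Lemma act_far F G n i j : (i.+1 < j)%N -> act F n i * act G n j = act G n j * act F n i.
Proof.
elim: n i j => [|n IHn] [|i] [|j] //= hij; last by rewrite !iso_tensM IHn.
case: n IHn => [|n] _; first by rewrite mul1g mulg1.
by case: j hij => // j _; apply: act_headC.
Qed.

Lemma act_yb R n i : yang_baxter R -> (i.+2 < n)%N ->
  act R n i * act R n i.+1 * act R n i = act R n i.+1 * act R n i * act R n i.+1.
Proof.
move=> hR; elim: n i => [|n IHn] [|i] hi; [by discriminate hi|by discriminate hi| |]; last first.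
  by rewrite /= !iso_tensM IHn.
case: n hi {IHn} => [|[|n]] hi; [by discriminate hi|by discriminate hi|].
apply: linIso_eq => z.
elim/tens_ind: z => [x z|a b ha hb]; last by rewrite !linearD ha hb.
elim/tens_ind: z => [y z|a b ha hb]; last by rewrite tensDr !linearD ha hb.
elim/tens_ind: z => [z w|a b ha hb]; last by rewrite !tensDr !linearD ha hb.
have sc : linear (fun c : K^o => c *: w)%R.
  by move=> a b c; rewrite scalerDl scalerA.
pose phi0 : {linear K^o -> tpow V n} := HB.pack (fun c : K^o => c *: w)%R
  (GRing.isLinear.Build K K^o (tpow V n) _ _ sc).
pose I : {linear V -> V} := idfun.
pose e := tmap I (tmap I (tmap I phi0)).
have e0 u : act R n.+3 0 (e u) = e (act R 3 0 u) by apply: act_head_nat.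
have e1 u : act R n.+3 1 (e u) = e (act R 3 1 u).
  elim/tens_ind: u => [u v|a b ha hb]; last by rewrite !linearD ha hb.
  rewrite /e tmapE.
  rewrite -[LHS]/(iso_tens (1 : GL V) (act R n.+2 0) (tens u _)).
  rewrite -[X in tmap _ _ X]/(iso_tens (1 : GL V) (act R 2 0) (tens u v)).
  rewrite !iso_tensE tmapE; congr tens.
  exact: (act_head_nat R phi0).
have -> : tens x (tens y (tens z w)) = e (tens x (tens y (tens z (1%R : K^o)))).
  by rewrite /e !tmapE /= scale1r.
rewrite !GL_mulE !(e0, e1); congr (e _).
by have := congr1 (fun f : GL (tpow V 3) => f (tens x (tens y (tens z (1%R : K^o))))) hR.
Qed.

End ActTheory.

(* A word is a sequence of letters (b, x), read as x if b = false and as x^-1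
   if b = true. *)
Definition word (X : Type) := seq (bool * X).

Section Presentation.
Variables (X : choiceType) (rels : word X -> word X -> Prop).

Inductive pres_rel : word X -> word X -> Prop :=
| pres_refl w : pres_rel w w
| pres_sym v w : pres_rel v w -> pres_rel w v
| pres_trans v u w : pres_rel u v -> pres_rel v w -> pres_rel u w
| pres_cat v v' w w' :
    pres_rel v v' -> pres_rel w w' -> pres_rel (v ++ w) (v' ++ w')
| pres_inv b x : pres_rel [:: (b, x); (~~ b, x)] [::]
| pres_rels v w : rels v w -> pres_rel v w.

Definition pres_relb v w := `[< pres_rel v w >].

Lemma pres_relb_equiv : equiv_class_of pres_relb.
Proof.
split=> [s|s t|t s r].
- by apply/asboolP; apply: pres_refl.
- by apply/asboolP/asboolP; apply: pres_sym.
- by move=> /asboolP h1 /asboolP h2; apply/asboolP; apply: pres_trans h1 h2.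
Qed.

Canonical pres_equiv := EquivRelPack pres_relb_equiv.

(* The group with generators X and relations v = w for rels v w. *)
Definition pres_group := {eq_quot pres_equiv}.
HB.instance Definition _ := Choice.on pres_group.
HB.instance Definition _ := EqQuotient.on pres_group.

Definition wcls (w : word X) : pres_group := \pi_pres_group w.

Lemma wclsP v w : wcls v = wcls w <-> pres_rel v w.
Proof. by split=> [/eqmodP/asboolP|h]; last by apply/eqmodP/asboolP. Qed.

Lemma wclsK (x : pres_group) : wcls (repr x) = x.
Proof. exact: reprK. Qed.

Lemma repr_wcls w : pres_rel (repr (wcls w)) w.
Proof. by apply/wclsP; rewrite wclsK. Qed.

Lemma wclsW (P : pres_group -> Prop) : (forall w, P (wcls w)) -> forall x, P x.
Proof. by move=> h x; rewrite -(wclsK x). Qed.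

Definition winv (w : word X) : word X := rev [seq (~~ l.1, l.2) | l <- w].

Lemma winvK : involutive winv.
Proof.
move=> w; rewrite /winv map_rev revK -map_comp; apply: map_id_in => -[b x] _ /=.
by rewrite negbK.
Qed.

Lemma winv_r w : pres_rel (w ++ winv w) [::].
Proof.
elim: w => [|[b x] w IHw]; first exact: pres_refl.
have -> : ((b, x) :: w) ++ winv ((b, x) :: w) =
    [:: (b, x)] ++ ((w ++ winv w) ++ [:: (~~ b, x)]).
  by rewrite /winv /= rev_cons -cats1 catA.
apply: pres_trans (pres_inv b x).
apply: (@pres_cat _ [:: (b, x)] _ [:: (~~ b, x)]); first exact: pres_refl.
by rewrite -[in X in pres_rel _ X](cat0s [:: _]); apply: pres_cat => //; apply: pres_refl.
Qed.

Lemma winv_l w : pres_rel (winv w ++ w) [::].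
Proof. by have := winv_r (winv w); rewrite winvK. Qed.

Lemma winv_rel v w : pres_rel v w -> pres_rel (winv v) (winv w).
Proof.
move=> h; apply: (@pres_trans (winv v ++ (w ++ winv w))).
  rewrite -{1}[winv v]cats0; apply: pres_cat; first exact: pres_refl.
  by apply: pres_sym; apply: winv_r.
rewrite catA -{2}[winv w]cat0s; apply: pres_cat; last exact: pres_refl.
apply: (@pres_trans (winv v ++ v)); last exact: winv_l.
by apply: pres_cat; [exact: pres_refl | exact: pres_sym].
Qed.

Definition pres_mul (x y : pres_group) := wcls (repr x ++ repr y).
Definition pres_invg (x : pres_group) := wcls (winv (repr x)).

Lemma pres_mulE v w : pres_mul (wcls v) (wcls w) = wcls (v ++ w).
Proof. by apply/wclsP; apply: pres_cat; apply: repr_wcls. Qed.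

Lemma pres_invgE w : pres_invg (wcls w) = wcls (winv w).
Proof. by apply/wclsP; apply: winv_rel; apply: repr_wcls. Qed.

Lemma pres_mulA : associative pres_mul.
Proof.
by elim/wclsW=> u; elim/wclsW=> v; elim/wclsW=> w; rewrite !pres_mulE catA.
Qed.

Lemma pres_mul1 : left_id (wcls [::]) pres_mul.
Proof. by elim/wclsW=> w; rewrite pres_mulE. Qed.

Lemma pres_mulr1 : right_id (wcls [::]) pres_mul.
Proof. by elim/wclsW=> w; rewrite pres_mulE cats0. Qed.

Lemma pres_mulV : left_inverse (wcls [::]) pres_invg pres_mul.
Proof.
by elim/wclsW=> w; rewrite pres_invgE pres_mulE; apply/wclsP; apply: winv_l.
Qed.

Lemma pres_mulrV : right_inverse (wcls [::]) pres_invg pres_mul.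
Proof.
by elim/wclsW=> w; rewrite pres_invgE pres_mulE; apply/wclsP; apply: winv_r.
Qed.

HB.instance Definition _ := isGroup.Build pres_group
  pres_mulA pres_mul1 pres_mulr1 pres_mulV pres_mulrV.

Definition pres_gen (x : X) : pres_group := wcls [:: (false, x)].

Lemma wcls_cat v w : wcls (v ++ w) = wcls v * wcls w.
Proof. by rewrite [RHS]pres_mulE. Qed.

Lemma wcls_nil : wcls [::] = 1.
Proof. by []. Qed.

Lemma wcls_cons l w :
  wcls (l :: w) = (if l.1 then (pres_gen l.2)^-1 else pres_gen l.2) * wcls w.
Proof.
rewrite -cat1s wcls_cat; congr (_ * _); case: l => -[] x //=.
by rewrite [RHS]pres_invgE.
Qed.

Variable G : groupType.

Definition weval (f : X -> G) (w : word X) : G :=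
  \prod_(l <- w) (if l.1 then (f l.2)^-1 else f l.2).

Lemma weval_cat f v w : weval f (v ++ w) = weval f v * weval f w.
Proof. exact: big_cat. Qed.

Variables (f : X -> G) (hf : forall v w, rels v w -> weval f v = weval f w).

Lemma weval_rel v w : pres_rel v w -> weval f v = weval f w.
Proof.
elim=> {v w} //.
- by move=> v u w _ -> _ ->.
- by move=> v v' w w' _ h1 _ h2; rewrite !weval_cat h1 h2.
- move=> b x; rewrite /weval !big_cons !big_nil mulg1 /=.
  by case: b; rewrite (mulVg, mulgV).
Qed.

(* The homomorphism determined by an assignment f of the generators that
   satisfies the relations; hf is used only in the proof that it is one. *)
Definition pres_hom (x : pres_group) : G := let _ := hf in weval f (repr x).

Lemma pres_hom_wcls w : pres_hom (wcls w) = weval f w.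
Proof. by apply: weval_rel; apply: repr_wcls. Qed.

Lemma pres_hom_morph : monoid.monoid_morphism pres_hom.
Proof.
split=> [|x y]; first by rewrite -wcls_nil pres_hom_wcls /weval big_nil.
elim/wclsW: x => v; elim/wclsW: y => w.
by rewrite -wcls_cat !pres_hom_wcls weval_cat.
Qed.

HB.instance Definition _ := isUMagmaMorphism.Build pres_group G pres_hom pres_hom_morph.

Lemma pres_hom_gen x : pres_hom (pres_gen x) = f x.
Proof. by rewrite pres_hom_wcls /weval big_seq1. Qed.

End Presentation.

Section BraidGroup.
Variable n : nat.
Local Notation s i := (false, i).

(* i : 'I_n.-1 stands for sigma_(i + 1) *)
Inductive braid_rels : word 'I_n.-1 -> word 'I_n.-1 -> Prop :=
| braid_rel_braid (i j : 'I_n.-1) : j = i.+1 :> nat ->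
    braid_rels [:: s i; s j; s i] [:: s j; s i; s j]
| braid_rel_comm (i j : 'I_n.-1) : (i.+1 < j)%N || (j.+1 < i)%N ->
    braid_rels [:: s i; s j] [:: s j; s i].

Definition braid_group := pres_group braid_rels.
HB.instance Definition _ := Group.on braid_group.

Definition braid_sigma (i : 'I_n.-1) : braid_group := pres_gen braid_rels i.

End BraidGroup.

Section NecklaceBraidGroup.
Variable n : nat.
Local Notation gen := ('I_n + unit)%type.
Local Notation s i := (false, inl i).
Local Notation t := (false, inr tt).
Local Notation t_inv := (true, inr tt).

(* inl i stands for sigma_(i + 1) and inr tt for tau; ordS is the successor
   modulo n on 'I_n *)
Inductive necklace_rels : word gen -> word gen -> Prop :=
| necklace_B1 (i : 'I_n) :
    necklace_rels [:: s i; s (ordS i); s i] [:: s (ordS i); s i; s (ordS i)]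
| necklace_B2 (i j : 'I_n) : i != ordS j -> j != ordS i ->
    necklace_rels [:: s i; s j] [:: s j; s i]
| necklace_N1 (i : 'I_n) : necklace_rels [:: t; s i; t_inv] [:: s (ordS i)]
| necklace_N2 : necklace_rels (nseq (2 * n)%N t) [::].

Definition necklace_group := pres_group necklace_rels.
HB.instance Definition _ := Group.on necklace_group.

Definition necklace_sigma (i : 'I_n) : necklace_group := pres_gen necklace_rels (inl i).
Definition necklace_tau : necklace_group := pres_gen necklace_rels (inr tt).

End NecklaceBraidGroup.

Section BraidToNecklace.
Variable n : nat.

Definition necklace_of_braid_gen (i : 'I_n.-1) : necklace_group n :=
  necklace_sigma (widen_ord (leq_pred n) i).

Lemma ordS_widen (i : 'I_n.-1) : ordS (widen_ord (leq_pred n) i) = i.+1 :> nat.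
Proof. by case: i => i hi /=; rewrite modn_small; lia. Qed.

Lemma necklace_of_braid_rels v w : braid_rels v w ->
  weval necklace_of_braid_gen v = weval necklace_of_braid_gen w.
Proof.
have wE u : weval necklace_of_braid_gen u =
    wcls (necklace_rels (n := n)) [seq (l.1, inl (widen_ord (leq_pred n) l.2)) | l <- u].
  by elim: u => [|l u IHu]; rewrite /weval ?big_nil // big_cons wcls_cons -IHu.
case=> [i j hij|i j hij]; rewrite !wE /=; apply/wclsP/pres_rels.
  have <- : ordS (widen_ord (leq_pred n) i) = widen_ord (leq_pred n) j.
    by apply: val_inj; rewrite [LHS]ordS_widen /= hij.
  exact: necklace_B1.
by apply: necklace_B2; rewrite -val_eqE [X in _ != X]ordS_widen /=; lia.
Qed.

(* The homomorphism from the braid group to the necklace braid group that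
   sends each sigma_i to sigma_i. *)
Definition necklace_of_braid : {multiplicative braid_group n -> necklace_group n} :=
  pres_hom necklace_of_braid_rels.

End BraidToNecklace.

Section BraidRepresentation.
Variables (K : fieldType) (V : lmodType K) (R : GL (V ⊗ V)) (hR : yang_baxter R).
Variable n : nat.

Lemma braid_rep_rels v w : braid_rels v w ->
  weval (fun i : 'I_n.-1 => act R n i) v = weval (fun i : 'I_n.-1 => act R n i) w.
Proof.
case=> [i j hij|i j hij]; rewrite /weval !big_cons !big_nil /= !mulg1 ?mulgA.
  have hi : (i.+2 < n)%N by have := ltn_ord j; lia.
  by rewrite hij; exact: (act_yb hR hi).
by case/orP: hij => hij; [|apply: esym]; apply: act_far.
Qed.

Definition braid_rep : {multiplicative braid_group n -> GL (tpow V n)} :=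
  pres_hom braid_rep_rels.

Lemma braid_rep_sigma i : braid_rep (braid_sigma i) = act R n i.
Proof. exact: pres_hom_gen. Qed.

End BraidRepresentation.

(* Main.v *)
(* On pure tensors [rho(tau)] is the cyclic shift
   [x_1 ⊗ ... ⊗ x_n |-> x_n ⊗ x_1 ⊗ ... ⊗ x_(n-1)], so its [n]-th power is [1],
   and it conjugates [R] acting at position [i] to [R] acting at position [i + 1].
   Putting [S_k = tau^k sigma_1 tau^-k] for all [k], which depends only on [k]
   modulo [n] and equals [sigma_(k + 1)] for [k < n - 1], the cyclic braid
   relations are conjugates by powers of [tau] of the relations among
   [sigma_1, ..., sigma_(n-1)]. *)
Require Import Defs.
From mathcomp Require Import all_boot all_algebra.
From mathcomp Require Import zify.

Set Implicit Arguments.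
Unset Strict Implicit.
Unset Printing Implicit Defensive.
Local Open Scope group_scope.

Section CyclicShift.
Variables (K : fieldType) (V : lmodType K).
Implicit Types R : GL (V ⊗ V).

Definition tshift n : GL (tpow V n) := \prod_(i < n.-1) act (flip V) n i.

Lemma iso_tens11 (U W : lmodType K) : iso_tens (1 : GL U) (1 : GL W) = 1 :> GL (U ⊗ W).
Proof.
apply: linIso_eq; elim/tens_ind=> [u w|x y hx hy]; first by rewrite iso_tensE.
by rewrite !GRing.linearD hx hy.
Qed.

Lemma tshiftSS n :
  tshift n.+2 = act (flip V) n.+2 0 * iso_tens (1 : GL V) (tshift n.+1).
Proof.
rewrite /tshift big_ord_recl; congr (_ * _); apply/esym.
by apply: (big_morph (fun g : GL (tpow V n.+1) => iso_tens (1 : GL V) g : GL (V ⊗ _)))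
  => [f g|]; rewrite ?iso_tensM ?mulg1 ?iso_tens11.
Qed.

Lemma act0E R n x y (w : tpow V n) :
  act R n.+2 0 (tens x (tens y w)) = assoc_inv V V (tpow V n) (tens (R (tens x y)) w).
Proof. exact: act_headE. Qed.

Lemma actSE R n i x (w : tpow V n) :
  act R n.+1 i.+1 (tens x w) = tens x (act R n i w).
Proof. exact: iso_tensE. Qed.

Lemma act_flip0E n x y (w : tpow V n) :
  act (flip V) n.+2 0 (tens x (tens y w)) = tens y (tens x w).
Proof. by rewrite act0E swap_funE assoc_invE. Qed.

(** Both sides send [x ⊗ y ⊗ z ⊗ w] to [z ⊗ R (x ⊗ y) ⊗ w]: the two flips carry [z] to the front
    past the pair. *)
Lemma flip_flip_act R n :
  act (flip V) n.+3 0 * act (flip V) n.+3 1 * act R n.+3 0 =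
  act R n.+3 1 * (act (flip V) n.+3 0 * act (flip V) n.+3 1).
Proof.
apply: linIso_eq.
elim/tens_ind=> [x z|a b ha hb]; last by rewrite !GRing.linearD ha hb.
elim/tens_ind: z => [y z|a b ha hb]; last by rewrite GRing.linearD !GRing.linearD ha hb.
elim/tens_ind: z => [z w|a b ha hb]; last by rewrite !GRing.linearD ha hb.
rewrite !GL_mulE actSE act_flip0E act_flip0E actSE !act0E.
(* [R (x ⊗ y)] need not be pure, so it is expanded into pure tensors. *)
elim/tens_ind: (R (tens x y)) => [a b|a b ha hb].
  by rewrite !assoc_invE actSE !act_flip0E.
by rewrite !tensDl !GRing.linearD ha hb.
Qed.

(** For [i = 0], split off the first two flips: the remaining factor [c] fixes positions 0 and 1, so
    it commutes with [R] there. For [i > 0], the first flip is disjoint from [R] at [i + 1], and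
    induction applies to the other factors. *)
Lemma tshift_act R n i : (i.+2 < n)%N ->
  tshift n * act R n i = act R n i.+1 * tshift n.
Proof.
elim: n i => [|[|[|n]] IHn] // [|i] hi; rewrite tshiftSS.
  pose c : GL (tpow V n.+3) := iso_tens (1 : GL V) (iso_tens (1 : GL V) (tshift n.+1)).
  have hC : act R n.+3 0 * c = c * act R n.+3 0 by apply: act_headC.
  have -> : iso_tens (1 : GL V) (tshift n.+2) = act (flip V) n.+3 1 * c :> GL (tpow V n.+3).
    by rewrite tshiftSS /c iso_tensM mulg1.
  by rewrite -!mulgA -hC !mulgA flip_flip_act -!mulgA.
have actS j : act R n.+3 j.+1 = iso_tens (1 : GL V) (act R n.+2 j) by [].
have -> : act R n.+3 i.+2 * (act (flip V) n.+3 0 * iso_tens (1 : GL V) (tshift n.+2)) =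
    act (flip V) n.+3 0 * (act R n.+3 i.+2 * iso_tens (1 : GL V) (tshift n.+2)).
  by rewrite !mulgA -(@act_far _ _ _ _ _ 0).
by rewrite -mulgA !actS !iso_tensM IHn.
Qed.

(** The pure tensor ends in the scalar [1] because [tpow V 0] is [K]; the default head [0] is never
    reached when [size s = n]. *)
Fixpoint tpure n (s : seq V) : tpow V n :=
  if n is m.+1 then tens (head 0%R s) (tpure m (behead s)) else (1%R : K^o).

Lemma linear_tpow_eq n (M : lmodType K) (f g : {linear tpow V n -> M}) :
  (forall s, size s = n -> f (tpure n s) = g (tpure n s)) -> f =1 g.
Proof.
elim: n f g => [|n IHn] f g hfg.
  move=> c; have -> : c = (c *: (1%R : K^o))%R :> tpow V 0 by exact/esym/GRing.mulr1.
  by rewrite !GRing.linearZ (hfg [::]).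
elim/tens_ind=> [u w|x y hx hy]; last by rewrite !GRing.linearD hx hy.
(* Fixing the first factor [u] leaves linear maps on the smaller tensor power. *)
have := IHn (f \o tens u) (g \o tens u); apply=> s hs.
by apply: (hfg (u :: s)); rewrite /= hs.
Qed.

(** The inner shift brings [x] to second place, and the outermost flip moves it past the head. *)
Lemma tshift_rcons n s x : size s = n ->
  tshift n.+1 (tpure n.+1 (rcons s x)) = tpure n.+1 (x :: s).
Proof.
elim: n s => [|n IHn] [|y s] //=; first by rewrite /tshift big_ord0.
move=> [hs].
rewrite tshiftSS GL_mulE [iso_tens _ _ _]iso_tensE.
by move: (IHn s hs) => /= ->; apply: act_flip0E.
Qed.

Lemma tshift_rot1 n s : size s = n -> tshift n (tpure n (rot 1 s)) = tpure n s.
Proof.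
case: n s => [|n] [|x s] //=; first by rewrite /tshift big_ord0.
move=> [hs].
by rewrite rot1_cons tshift_rcons.
Qed.

Lemma tshiftX_rot n k s : size s = n -> (k <= n)%N ->
  (tshift n ^+ k) (tpure n (rot k s)) = tpure n s.
Proof.
move=> hs; elim: k => [|k IHk] hk; first by rewrite rot0.
by rewrite expgSr GL_mulE rotS ?hs // tshift_rot1 ?size_rot ?IHk // ltnW.
Qed.

(** Each shift undoes one left rotation, and [rot n] fixes lists of length [n]. *)
Lemma tshiftXn n : tshift n ^+ n = 1.
Proof.
apply: linIso_eq; apply: linear_tpow_eq => s hs.
by rewrite -{1}(rot_size s) hs tshiftX_rot.
Qed.

End CyclicShift.

Section CyclicConjugates.
Variables (G : groupType) (t : G) (n : nat) (s : nat -> G).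
Hypothesis tX : t ^+ n = 1.
Hypothesis ts : forall i, (i.+2 < n)%N -> t * s i = s i.+1 * t.

(** As [x ^ y] is [y^-1 * x * y], this is [t ^+ k * s 0 * t ^- k]. *)
Definition cyclic_conj k : G := s 0 ^ (t ^- k).

Lemma cyclic_conjD i k : cyclic_conj (i + k) = cyclic_conj i ^ (t ^- k).
Proof. by rewrite /cyclic_conj addnC expgnDr invgM conjgM. Qed.

Lemma cyclic_conjS k : cyclic_conj k.+1 = t * cyclic_conj k * t^-1.
Proof. by rewrite -addn1 cyclic_conjD conjgE invgK expg1 mulgA. Qed.

Lemma cyclic_conj_small k : (k.+1 < n)%N -> cyclic_conj k = s k.
Proof.
elim: k => [|k IHk] hk; first by rewrite /cyclic_conj invg1 conjg1.
by rewrite cyclic_conjS IHk 1?ltnW // ts // mulgK.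
Qed.

Lemma cyclic_conj_mod k : cyclic_conj (k %% n) = cyclic_conj k.
Proof.
by rewrite {2}(divn_eq k n) addnC cyclic_conjD mulnC expgnA tX expg1n invg1 conjg1.
Qed.

Lemma cyclic_conj_ordS (i : 'I_n) : cyclic_conj (ordS i) = t * cyclic_conj i * t^-1.
Proof. by rewrite cyclic_conj_mod cyclic_conjS. Qed.

Lemma cyclic_conj_braid (i : 'I_n) : (2 < n)%N -> s 0 * s 1 * s 0 = s 1 * s 0 * s 1 ->
  cyclic_conj i * (cyclic_conj (ordS i) * cyclic_conj i) =
  cyclic_conj (ordS i) * (cyclic_conj i * cyclic_conj (ordS i)).
Proof.
(* Writing the indices as [0 + i] and [1 + i] exhibits the relation as the conjugate by [t ^- i] of
   the one between [s 0] and [s 1]. *)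
move=> hn hs; rewrite cyclic_conj_mod -add1n -{1 3 5}[val i]add0n !cyclic_conjD.
by rewrite -!conjMg !cyclic_conj_small ?mulgA ?hs // ltnW.
Qed.

Lemma cyclic_conj_comm (i j : 'I_n) :
    (forall k, (1 < k)%N -> (k.+1 < n)%N -> s 0 * s k = s k * s 0) ->
    i != ordS j -> j != ordS i ->
  cyclic_conj i * cyclic_conj j = cyclic_conj j * cyclic_conj i.
Proof.
move=> hs; wlog ltij : i j / (i < j)%N => [hw|] hij hji.
  have [ij|ji|/val_inj -> //] := ltngtP i j; first exact: hw.
  by apply/esym/hw.
have hj := ltn_ord j.
have hji1 : j != i.+1 :> nat.
  by apply: contra_neq hji => h; apply: val_inj; rewrite /= -h modn_small.
(* Otherwise [i = 0] and [j = n - 1], which are cyclic neighbours. *)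
have hwrap : (j - i).+1 < n.
  case: (ltnP (j - i).+1 n) => // h; case/eqP: hij; apply: val_inj => /=.
  have [-> ->] : i = 0%N :> nat /\ j.+1 = n by lia.
  by rewrite modnn.
(* Up to conjugation by [t ^- i] the indices are [0] and [j - i], with [1 < j - i < n - 1]. *)
rewrite -(subnKC (ltnW ltij)) addnC -{1 4}[val i]add0n !cyclic_conjD -!conjMg.
by rewrite !cyclic_conj_small; [rewrite hs //|..]; lia.
Qed.

End CyclicConjugates.

Section NecklaceRepresentation.
Variables (K : fieldType) (V : lmodType K) (R : GL (V ⊗ V)) (hR : yang_baxter R).
Variables (n : nat) (hn : (3 <= n)%N).

(** Conjugates replace [act R n i] because the latter is the identity at [i = n - 1]; they agree
    with it at smaller [i]. *)
Definition necklace_rep_gen (x : 'I_n + unit) : GL (tpow V n) :=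
  if x is inl i then cyclic_conj (tshift V n) (act R n) i else tshift V n.

Lemma necklace_rep_rels v w : necklace_rels v w ->
  weval necklace_rep_gen v = weval necklace_rep_gen w.
Proof.
have ts := @tshift_act _ _ R n; have tX := tshiftXn V n.
case=> [i|i j hij hji|i|]; rewrite /weval ?big_cons ?big_nil ?mulg1 /=.
- exact: (cyclic_conj_braid tX ts i hn (act_yb hR hn)).
- by apply: (cyclic_conj_comm ts _ hij hji) => k hk _; apply: act_far.
- by rewrite mulgA cyclic_conj_ordS.
- by rewrite big_nseq iter_mulg_1 mulnC expgnA tX expg1n.
Qed.

Definition necklace_rep : {multiplicative necklace_group n -> GL (tpow V n)} :=
  pres_hom necklace_rep_rels.

Lemma necklace_rep_sigma i :
  necklace_rep (necklace_sigma i) = cyclic_conj (tshift V n) (act R n) i.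
Proof. exact: pres_hom_gen. Qed.

Lemma necklace_rep_tau : necklace_rep (necklace_tau n) = tshift V n.
Proof. exact: pres_hom_gen. Qed.

(** Two homomorphisms are compared letter by letter on a word; braid generators have [i + 1 < n], so
    no index wraps around. *)
Lemma necklace_rep_braid b : necklace_rep (necklace_of_braid n b) = braid_rep hR n b.
Proof.
elim/wclsW: b => w.
rewrite [necklace_of_braid n _]pres_hom_wcls [RHS]pres_hom_wcls /weval gmulf_prod.
apply: eq_bigr => -[c i] _ /=.
have hi : necklace_rep (necklace_of_braid_gen i) = act R n i.
  rewrite necklace_rep_sigma; apply: (cyclic_conj_small (@tshift_act _ _ R n)).
  by have := ltn_ord i; rewrite /=; lia.
by case: c; rewrite ?gmulfV hi.
Qed.

End NecklaceRepresentation.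

Theorem theorem4p2 (K : fieldType) (V : lmodType K)
    (R : GL (V ⊗ V)) (hR : yang_baxter R) (n : nat) (hn : (3 <= n)%N) :
  exists rho : {multiplicative necklace_group n -> GL (tpow V n)},
    [/\ forall b : braid_group n,
          rho (necklace_of_braid n b) = braid_rep hR n b,
        rho (necklace_tau n) = \prod_(i < n.-1) act (flip V) n i
      & forall i j : 'I_n, i = n.-2 :> nat -> j = n.-1 :> nat ->
          rho (necklace_sigma j) =
            rho (necklace_tau n) * rho (necklace_sigma i) * (rho (necklace_tau n))^-1].
Proof.
exists (necklace_rep hR hn); split=> [b||i j hi hj].
- exact: necklace_rep_braid.
- exact: necklace_rep_tau.
(* The formula for the last generator is the conjugation recursion from index [n - 2] to [n - 1]. *)
rewrite !necklace_rep_sigma necklace_rep_tau -cyclic_conjS hi hj.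
by congr cyclic_conj; lia.
Qed.
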